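(* Let $k\ge 1$ be an integer, let $G$ be a connected triangle-free graph, and let $v\in V(G)$. If $G$ contains no induced subgraph on $k+1$ vertices that is a tree containing $v$, then $|V(G)\setminus N[v]|\le \frac{(k-2)(k-1)}{2}$.
   Context: All graphs are simple and finite. $N[v]$ denotes the closed neighborhood of $v$, i.e. $v$ together with all vertices adjacent to $v$. *)

(* Defs.v *)
From mathcomp Require Import all_boot.
Set Implicit Arguments. Unset Strict Implicit. Unset Printing Implicit Defensive.

Definition simple_graph (T : finType) (e : rel T) : Prop :=
  symmetric e /\ irreflexive e.

Definition connected_graph (T : finType) (e : rel T) : Prop :=
  forall x y : T, connect e x y.

Definition triangle_free (T : finType) (e : rel T) : Prop :=
  forall x y z : T, ~ [&& e x y, e y z & e z x].

Definition closed_nbhd (T : finType) (e : rel T) (v : T) : {set T} :=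
  [set u | (u == v) || e v u].

Definition induced_rel (T : finType) (e : rel T) (S : {set T}) : rel T :=
  [rel x y | [&& x \in S, y \in S & e x y]].

Definition induced_connected (T : finType) (e : rel T) (S : {set T}) : Prop :=
  S != set0 /\ forall x y, x \in S -> y \in S -> connect (induced_rel e S) x y.

Definition induced_acyclic (T : finType) (e : rel T) (S : {set T}) : Prop :=
  forall c : seq T, all (mem S) c -> uniq c -> 3 <= size c -> ~~ cycle e c.

Definition induced_tree (T : finType) (e : rel T) (S : {set T}) : Prop :=
  induced_connected e S /\ induced_acyclic e S.

(* Main.v *)
(** Grow induced trees by adding vertices with exactly one neighbour in the
tree, and argue by induction on the size of the graph.  Let [C i] be the
components of [G - N[v]], and let [b i] be least with [#|C i| <= 'C(b i + 1, 2)].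
By induction every neighbour [w] of [v] adjacent to [C i] carries an induced tree
with at least [b i] vertices in [C i].  For a set [X] of neighbours of [v], the
trees in the components adjacent to exactly one vertex of [X] can be glued to the
star on [v |: X], since [X] is independent; hence
[1 + #|X| + \sum b i <= k] over those components.

It remains to see that this forces [\sum_i 'C(b i + 1, 2) <= 'C(k - 1, 2)].
Shrink the set of neighbours to a minimal one meeting all components, pick [w] in
it and lower [b i] by one on all components adjacent to [w].  The sum drops by the
total weight around [w], which is at most [k - 2] (take [X = [set w]]), and the
bound on every [X] drops by one: if no weight adjacent to [w] was counted for [X],
then [w] is not in [X] by minimality, and [w |: X] counts one vertex more. *)

From Stdlib Require Import Classical_Prop.
Require Import Defs.
From mathcomp Require Import all_boot zify.

Set Implicit Arguments. Unset Strict Implicit. Unset Printing Implicit Defensive.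

(** * Covering inequality for weighted components *)

Lemma once_hit_bound (V I : finType) (h : I -> {set V}) (K : nat) (A : {set V})
    (b : I -> nat) :
  (forall i, 0 < b i -> h i :&: A != set0) ->
  (forall X : {set V}, X \subset A ->
     #|X| + \sum_(i | #|h i :&: X| == 1) b i <= K.+1) ->
  \sum_i 'C((b i).+1, 2) <= 'C(K.+1, 2).
Proof.
(* In use, [h i] is the set of neighbours of the root attached to component [i], and [K.+2] bounds
   the tree sizes. For [K = 0] the singletons force every weight to vanish. *)
elim: K A b => [|K IHK] A b cov bnd.
  rewrite big1 // => i _; case: (posnP (b i)) => [-> //|bi].
  have /set0Pn[w /setIP[wi wA]] := cov _ bi.
  have sX : [set w] \subset A by rewrite sub1set.
  have := bnd _ sX; rewrite cards1 (bigD1 i) /=; first by lia.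
  by rewrite (setIidPr _) ?sub1set // cards1.
move En: #|A| => n; elim: n A En cov bnd => [|n IHn] A En cov bnd.
  rewrite big1 // => i _; case: (posnP (b i)) => [-> //|/cov].
  by rewrite (cards0_eq En) setI0 eqxx.
have /card_gt0P[w wA] : 0 < #|A| by rewrite En.
case: (boolP [forall i, (0 < b i) ==> (h i :&: (A :\ w) != set0)]) =>
    [/forallP cov'|].
  apply: (IHn (A :\ w)).
  - by rewrite (cardsD1 w) wA in En; lia.
  - by move=> i bi; move/implyP: (cov' i); apply.
  - by move=> X sX; apply: bnd; apply: subset_trans sX (subD1set _ _).
(* Discarding [w] uncovers [i0], so [w] is the only vertex of [A] attached to [i0]. *)
case/forallPn => i0; rewrite negb_imply negbK => /andP[bi0 /eqP priv].
have privw (X : {set V}) : X \subset A -> w \in X -> h i0 :&: X = [set w].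
  move=> sX wX; have /set0Pn[w' /setIP[w'i w'A]] := cov _ bi0.
  have eqw z : z \in h i0 -> z \in A -> z = w.
    move=> zi zA; apply/eqP; apply: contraT => zw.
    by have := in_set0 z; rewrite -priv !inE zi zA zw.
  apply/setP => z; rewrite !inE; apply/andP/eqP => [[zi zX]|->].
    by apply: eqw => //; apply: (subsetP sX).
  by rewrite -{1}(eqw w').
pose b' i := b i - (w \in h i).
have hw (X : {set V}) i : #|h i :&: (w |: X)| = (w \in h i) && (w \notin X) + #|h i :&: X|.
  rewrite setIUr; case: (boolP (w \in h i)) => wi /=.
    rewrite (setIidPr _) ?sub1set // cardsU1 inE wi //.
  suff -> : h i :&: [set w] = set0 by rewrite set0U.
  by apply/setP => z; rewrite !inE; apply/andP => -[zi /eqP zw]; rewrite -zw zi in wi.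
have b'le : \sum_i 'C((b' i).+1, 2) <= 'C(K.+1, 2).
  apply: (IHK A) => [i|X sX].
    by rewrite /b' => bi; apply: cov; lia.
  case: (boolP [exists j, [&& #|h j :&: X| == 1, w \in h j & 0 < b j]]).
    case/existsP => j /and3P[jX wj bj]; have := bnd _ sX.
    rewrite !(bigD1 (P := fun i => #|h i :&: X| == 1) j) //= /b' wj.
    have : \sum_(i | (#|h i :&: X| == 1) && (i != j)) (b i - (w \in h i)) <=
           \sum_(i | (#|h i :&: X| == 1) && (i != j)) b i.
      by apply: leq_sum => i _; lia.
    lia.
  move/existsPn => none.
  (* If [w] were in [X], then [i0] would be a positive weight adjacent to [w] and counted for
     [X]. *)
  have wX : w \notin X.
    apply: (contraL _ (none i0)) => wX; rewrite negbK privw // cards1 bi0 andbT /=.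
    by have := set11 w; rewrite -(privw X) // inE => /andP[].
  have swX : w |: X \subset A by rewrite subUset sub1set wA.
  have := bnd _ swX; rewrite cardsU1 wX add1n addSn ltnS; apply: leq_trans.
  (* Components counted for [X] and adjacent to [w] have weight zero here; the other counted ones
     remain counted for [w |: X]. *)
  rewrite leq_add2l big_mkcond [leqRHS]big_mkcond /=; apply: leq_sum => i _.
  have := none i; rewrite hw wX andbT /b'; case: (w \in h i) => /=; last by rewrite subn0.
  by case: (#|h i :&: X| == 1) => //=; rewrite -leqNgt leqn0 => /eqP->.
have stepw : \sum_i 'C((b i).+1, 2) =
    \sum_i 'C((b' i).+1, 2) + \sum_(i | w \in h i) b i.
  rewrite [X in _ + X]big_mkcond -big_split; apply: eq_bigr => i _ /=.
  rewrite /b'; case: (w \in h i); last by rewrite subn0 addn0.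
  by case: (b i) => // n'; rewrite subn1 [in LHS]binS bin1.
have sw : [set w] \subset A by rewrite sub1set.
have := bnd _ sw; rewrite cards1 add1n ltnS (eq_bigl (fun i => w \in h i)) => [bw|i].
  by rewrite stepw binS bin1 leq_add.
by have := hw set0 i; rewrite setU0 setI0 cards0 in_set0 andbT addn0 => ->; case: (w \in h i).
Qed.

(** Supplies the least [b]; the guard leaves out [b = 0], which has no smaller index to exclude. *)
Lemma triangular_root n : exists b, n <= 'C(b.+1, 2) /\ (0 < b -> 'C(b, 2) < n).
Proof.
elim: n => [|n [b [le_n gt_n]]]; first by exists 0.
case: (leqP n.+1 'C(b.+1, 2)) => [le_n1|lt_n1].
  by exists b; split=> // /gt_n; apply: ltnW.
exists b.+1; split=> //; rewrite binS bin1; lia.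
Qed.

(** * Induced trees grown leaf by leaf *)

Section Graph.

Variables (T : finType) (e : rel T).
Hypotheses (sym_e : symmetric e) (irr_e : irreflexive e) (tf_e : triangle_free e).
Implicit Types (D S U X : {set T}) (u v w x y z : T).

Lemma induced_relE S x y : induced_rel e S x y = [&& x \in S, y \in S & e x y].
Proof. by []. Qed.

Lemma induced_rel_sym S : connect_sym (induced_rel e S).
Proof.
by apply: sym_connect_sym => x y; rewrite !induced_relE sym_e andbCA.
Qed.

(** Presents an induced tree rooted at [v] by an order in which its vertices are added as leaves, so
    that facts about trees follow by structural induction. *)
Inductive grown_tree v : {set T} -> Prop :=
| GrownRoot : grown_tree v [set v]
| GrownLeaf U x y : grown_tree v U -> x \notin U -> y \in U -> e x y ->
    (forall z, z \in U -> e x z -> z = y) -> grown_tree v (x |: U).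

Lemma grown_tree_root v U : grown_tree v U -> v \in U.
Proof. by elim=> [|U' x y _ vU _ _ _ _]; rewrite !inE ?vU ?orbT. Qed.

Lemma grown_tree_connect v U x :
  grown_tree v U -> x \in U -> connect (induced_rel e U) v x.
Proof.
move=> tU; elim: tU x => {U} [x /set1P-> //|U a y tU IH aU yU eay _ x].
have mono : subrel (connect (induced_rel e U)) (connect (induced_rel e (a |: U))).
  apply: connect_sub => p q /and3P[pU qU epq]; apply: connect1.
  by rewrite induced_relE !inE pU qU epq !orbT.
case/setU1P => [->|/IH/mono //].
apply: connect_trans (mono _ _ (IH _ yU)) _; apply: connect1.
by rewrite induced_relE !inE yU eqxx orbT sym_e.
Qed.

(** The last leaf has a single neighbour, so no cycle passes through it, and a cycle avoiding it
    lies in the smaller tree. *)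
Lemma grown_tree_acyclic v U : grown_tree v U -> induced_acyclic e U.
Proof.
elim=> {U} [|U x y tU IH xU yU exy uniq_y] c c_in uc sz.
  have : size c <= size [:: v].
    by apply: uniq_leq_size => // z /(allP c_in)/set1P->; rewrite mem_head.
  by move=> /= ?; lia.
case: (boolP (x \in c)) => xc; last first.
  apply: IH => //; apply/allP => z zc; have := allP c_in _ zc.
  by rewrite /= !inE => /predU1P[zx|//]; rewrite -zx zc in xc.
case/rot_to: xc => i p def_c; rewrite -(rot_cycle i) def_c.
have {}uc : uniq (x :: p) by rewrite -def_c rot_uniq.
have {}sz : 2 < size (x :: p) by rewrite -def_c size_rot.
have {}c_in z : z \in p -> z \in U.
  move=> zp; have zc : z \in c by rewrite -(mem_rot i) def_c inE zp orbT.
  have := allP c_in _ zc; rewrite /= !inE => /predU1P[zx|//].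
  by move: uc; rewrite /= -zx zp.
(* With [x] rotated to the front, [a] and [b] are its two neighbours on the cycle, at different
   positions since the length is at least 3. *)
case: p => [|a p] // in uc sz c_in {def_c} *; case/lastP: p => [|p b] // in uc sz c_in *.
apply/negP; rewrite /= !rcons_path last_rcons => /and3P[exa _ ebx].
have ay : a = y by apply: uniq_y => //; apply: c_in; rewrite inE eqxx.
have b_y : b = y.
  by apply: uniq_y; [apply: c_in; rewrite inE mem_rcons inE eqxx orbT | rewrite sym_e].
by move: uc; rewrite /= mem_rcons inE ay b_y eqxx andbF.
Qed.

Lemma grown_tree_induced v U : grown_tree v U -> induced_tree e U.
Proof.
move=> tU; split; last exact: grown_tree_acyclic tU.
split; first by apply/set0Pn; exists v; apply: grown_tree_root.
move=> x y xU yU; apply: (connect_trans (y := v)).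
  by rewrite induced_rel_sym; apply: grown_tree_connect.
exact: grown_tree_connect.
Qed.

(** Growth adds one vertex at a time, so stopping early reaches every smaller size. *)
Lemma grown_tree_card v U n : grown_tree v U -> 0 < n <= #|U| ->
  exists2 U', grown_tree v U' & #|U'| = n.
Proof.
elim=> {U} [|U x y tU IH xU yU exy uniq_y] /andP[n0 nU].
  by exists [set v]; [apply: GrownRoot | rewrite cards1 in nU *; lia].
case: (leqP n #|U|) => [nU'|nU']; first by apply: IH; rewrite n0.
exists (x |: U); first exact: GrownLeaf exy uniq_y.
by move: nU; rewrite cardsU1 xU; lia.
Qed.

(** The growth of [D] is replayed on top of [U]: since [w] is the only point of contact, each new
    vertex is still a leaf. *)
Lemma grown_tree_glue v w U D : grown_tree v U -> grown_tree w D -> w \in U ->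
  (forall x, x \in D -> x != w ->
     x \notin U /\ (forall z, z \in U -> e x z -> z = w)) ->
  grown_tree v (U :|: D).
Proof.
move=> tU tD wU; elim: tD => {D} [_|D x y tD IH xD yD exy uniq_y sep].
  by rewrite setUC (setUidPr _) ?sub1set.
have wD := grown_tree_root tD.
have xw : x != w by apply: contraNneq xD => ->.
have [xU sepx] := sep x (setU11 _ _) xw.
rewrite setUCA; apply: (GrownLeaf (y := y)) => //.
- by apply: IH => z zD; apply: sep; rewrite !inE zD orbT.
- by rewrite inE negb_or xU.
- by rewrite inE yD orbT.
move=> z /setUP[zU|zD] exz; last exact: uniq_y.
have zw := sepx _ zU exz; by apply: uniq_y => //; rewrite zw.
Qed.

Lemma nbrs_independent v x y : e v x -> e v y -> ~~ e x y.
Proof.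
move=> vx vy; apply/negP => xy.
by apply: (tf_e (x := v) (y := x) (z := y)); rewrite vx xy sym_e.
Qed.

(** Neighbours of [v] are independent, so each of them can be added as a leaf at [v]. *)
Lemma grown_tree_star v X : (forall x, x \in X -> e v x) -> grown_tree v (v |: X).
Proof.
move En: #|X| => n; elim: n X En => [|n IH] X En vX.
  by rewrite (cards0_eq En) setU0; apply: GrownRoot.
have /card_gt0P[x xX] : 0 < #|X| by rewrite En.
have vx := vX _ xX.
have -> : v |: X = x |: (v |: (X :\ x)) by rewrite setUCA setD1K.
apply: (GrownLeaf (y := v)).
- apply: IH => [|z /setD1P[_ /vX] //].
  by rewrite (cardsD1 x) xX in En; lia.
- by rewrite !inE eqxx /= orbF; apply: contraTneq vx => ->; rewrite irr_e.
- exact: setU11.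
- by rewrite sym_e.
move=> z /setU1P[-> //|/setD1P[_ /vX vz]] exz.
by have := nbrs_independent vx vz; rewrite exz.
Qed.

(** The induction on graph size runs over vertex sets of one fixed graph, so connectivity is
    relative to [S] and measured from a root. *)
Definition rooted_connected S v :=
  forall x, x \in S -> connect (induced_rel e S) v x.

(** * Components of the non-neighbours of the root *)

Section Components.

Variables (S : {set T}) (v : T).
Hypotheses (vS : v \in S) (conS : rooted_connected S v).

Let W := [set x in S | e v x].
Let R := S :\: closed_nbhd e v.
Let r := induced_rel e R.
(** Components are indexed by their canonical representatives; any other index gives the empty
    set. *)
Let C i := [set x in R | root r x == i].
Let h i := [set w in W | [exists x in C i, e w x]].

Lemma component_closed i x y : x \in C i -> y \in R -> e x y -> y \in C i.
Proof.
rewrite !inE => /andP[xR /eqP<-] yR exy; rewrite yR /= eq_sym.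
rewrite (root_connect (induced_rel_sym R)); apply: connect1.
by rewrite induced_relE !inE xR yR.
Qed.

Lemma component_sub i : C i \subset R.
Proof. by apply/subsetP => x; rewrite inE => /andP[]. Qed.

(** Otherwise [C i] would be closed under adjacency in [S], and connectivity would place [v] in
    it. *)
Lemma component_attached i : C i != set0 -> h i != set0.
Proof.
case/set0Pn => x xi; apply/negP => /eqP hi0.
have cl : closed (induced_rel e S) (C i).
  apply: (intro_closed (induced_rel_sym S)) => y z /and3P[yS zS eyz] yi.
  have nvy : ~~ e v y.
    by have := subsetP (component_sub i) _ yi; rewrite !inE negb_or -andbA => /and3P[].
  case: (boolP (z \in R)) => zR; first exact: component_closed yi zR eyz.
  have : z \in closed_nbhd e v by move: zR; rewrite !inE zS andbT negbK.
  rewrite inE => /predU1P[zv|vz]; first by rewrite sym_e -zv eyz in nvy.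
  have := in_set0 z; rewrite -hi0 !inE zS vz /=.
  by move=> /existsP[]; exists y; rewrite yi sym_e.
have xS : x \in S by have := subsetP (component_sub i) _ xi; rewrite inE => /andP[].
have := closed_connect cl (conS xS); rewrite xi => vi.
by have := subsetP (component_sub i) _ vi; rewrite !inE eqxx.
Qed.

Lemma component_rooted_connected i w : w \in h i -> rooted_connected (w |: C i) w.
Proof.
rewrite inE => /andP[_ /existsP[x /andP[xi ewx]]].
pose Y := [pred y | connect (induced_rel e (w |: C i)) w y].
have Yx : Y x.
  by apply: connect1; rewrite induced_relE setU11 ewx in_setU1 xi orbT.
(* The implication makes the predicate trivially true on the other components, hence closed for all
   of [r]. *)
have cl : closed r [pred y | (y \in C i) ==> Y y].
  apply: (intro_closed (induced_rel_sym R)) => y z /and3P[yR zR eyz].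
  move=> /implyP Yy; apply/implyP => zi.
  have yi : y \in C i by apply: component_closed zi yR _; rewrite sym_e.
  apply: connect_trans (Yy yi) _.
  by apply: connect1; rewrite induced_relE !in_setU1 yi zi eyz !orbT.
move=> y /setU1P[-> //|yi].
have xy : connect r x y.
  move: xi yi; rewrite !inE => /andP[_ /eqP<-] /andP[_ /eqP].
  by move/eqP; rewrite eq_sym (root_connect (induced_rel_sym R)).
have Py : y \in [pred y | (y \in C i) ==> Y y].
  by rewrite -(closed_connect cl xy); apply/implyP.
exact: (implyP Py).
Qed.

(** The components in [s] are treated one by one, starting from the star on [v |: X]; the invariant
    that all further vertices lie in components already treated keeps the next tree separate. *)
Lemma glued_tree (b : T -> nat) X (s : seq T) :
  (forall i w, w \in h i ->
     exists2 D, grown_tree w D & D \subset w |: C i /\ b i < #|D|) ->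
  X \subset W -> uniq s -> (forall i, i \in s -> #|h i :&: X| == 1) ->
  exists2 U, grown_tree v U &
    [/\ v |: X \subset U,
        forall x, x \in U -> x \notin v |: X -> exists2 i, i \in s & x \in C i,
        U \subset S & (#|X| + \sum_(i <- s) b i).+1 <= #|U|].
Proof.
move=> trees sXW.
have XW x : x \in X -> x \in S /\ e v x by move/(subsetP sXW); rewrite inE => /andP.
have XR x : x \in v |: X -> x \notin R.
  by case/setU1P => [->|/XW[xS vx]]; rewrite !inE ?eqxx // vx orbT.
elim: s => [_ _|i s IH /= /andP[is_ us] once].
  exists (v |: X); first by apply: grown_tree_star => x /XW[].
  split=> //; first by move=> x ->.
    by apply/subsetP => x /setU1P[-> //|/XW[]].
  rewrite big_nil addn0 cardsU1; suff -> : v \notin X by [].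
  by apply/negP => /XW[_]; rewrite irr_e.
have [|U tU [sXU UC US cU]] := IH us; first by move=> j js; apply: once; rewrite inE js orbT.
have /cards1P[w hw] := once i (mem_head _ _).
have /setIP[wi wX] : w \in h i :&: X by rewrite hw set11.
have [D tD [sD cD]] := trees _ _ wi.
have wU : w \in U by apply: (subsetP sXU); rewrite !inE wX orbT.
have DC x : x \in D -> x != w -> x \in C i.
  by move=> /(subsetP sD)/setU1P[->|//]; rewrite eqxx.
have CR x j : x \in C j -> x \in R by move/(subsetP (component_sub j)).
have Cinj x j : x \in C i -> x \in C j -> i = j.
  by rewrite !inE => /andP[_ /eqP<-] /andP[_ /eqP<-].
(* Such an [x] lies in [C i]: it is adjacent neither to [v] nor to another component, and [w] is its
   only possible neighbour in [X]. *)
have sep x : x \in D -> x != w -> x \notin U /\ (forall z, z \in U -> e x z -> z = w).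
  move=> xD xw; have xi := DC _ xD xw; have xR := CR _ _ xi; split.
    apply/negP => xU; case: (boolP (x \in v |: X)) => [/XR|nx]; first by rewrite xR.
    by have [j js xj] := UC _ xU nx; rewrite (Cinj _ _ xi xj) js in is_.
  move=> z zU exz; case: (boolP (z \in v |: X)) => [|nz].
    case/setU1P => [zv|zX].
      by move: xR; rewrite !inE -zv sym_e exz orbT.
    apply/set1P; rewrite -hw inE zX andbT inE (subsetP sXW) //=.
    by apply/existsP; exists x; rewrite xi sym_e.
  have [j js zj] := UC _ zU nz.
  have zi := component_closed xi (CR _ _ zj) exz.
  by rewrite (Cinj _ _ zi zj) js in is_.
exists (U :|: D); first exact: (grown_tree_glue tU tD wU sep).
split.
- exact: subset_trans sXU (subsetUl _ _).
- move=> x /setUP[xU nx|xD nx].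
    by have [j js xj] := UC _ xU nx; exists j => //; rewrite inE js orbT.
  exists i; first exact: mem_head.
  by apply: DC => //; apply: contraNneq nx => ->; rewrite !inE wX orbT.
- rewrite subUset US; apply/subsetP => x /(subsetP sD)/setU1P[->|/CR].
    by have [] := XW _ wX.
  by rewrite inE => /andP[].
(* The overlap is one vertex, so gluing [D] adds at least [b i] vertices. *)
have UD : U :&: D = [set w].
  apply/setP => x; rewrite in_setI in_set1; apply/andP/eqP => [[xU xD]|->].
    by apply/eqP; apply: contraT => xw; have [] := sep _ xD xw; rewrite xU.
  by split=> //; apply: grown_tree_root.
have := cardsUI U D; rewrite UD cards1 big_cons; lia.
Qed.

(** The component bound is kept as a hypothesis so that it can come from the induction hypothesis
    first and from the finished cardinality bound later. *)
Lemma non_nbrs_bound_of_components k :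
  (forall i w m, w \in h i ->
     (forall D, D \subset w |: C i -> grown_tree w D -> #|D| <= m.+1) ->
     #|C i| <= 'C(m.+1, 2)) ->
  (forall U, U \subset S -> grown_tree v U -> #|U| <= k.+2) ->
  #|R| <= 'C(k.+1, 2).
Proof.
move=> compB treeB.
have [b bP] := fin_all_exists (fun i => triangular_root #|C i|).
have -> : #|R| = \sum_i #|C i|.
  rewrite -sum1_card (partition_big (root r) predT) //=.
  by apply: eq_bigr => i _; rewrite -sum1_card; apply: eq_bigl => x; rewrite [in RHS]inE.
apply: (@leq_trans (\sum_i 'C((b i).+1, 2))).
  by apply: leq_sum => i _; have [] := bP i.
(* If all trees at [w] had at most [b i] vertices, the component bound with [m = (b i).-1] would
   contradict the minimality of [b i]. *)
have trees i w : w \in h i -> exists2 D, grown_tree w D & D \subset w |: C i /\ b i < #|D|.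
  move=> wi; apply: NNPP => noD.
  have {}noD D : D \subset w |: C i -> grown_tree w D -> #|D| <= b i.
    by move=> sD tD; rewrite leqNgt; apply/negP => ltD; apply: noD; exists D.
  have wgt0 : 0 < b i.
    by have := noD [set w] _ (GrownRoot w); rewrite sub1set setU11 cards1; apply.
  have [_ /(_ wgt0)] := bP i; rewrite ltnNge => /negP; apply.
  have := compB i w (b i).-1 wi; rewrite prednK //; exact.
apply: (once_hit_bound (h := h) (A := W)) => [i bi|X sX].
  suff -> : h i :&: W = h i.
    by apply: component_attached; have [_ /(_ bi) lt] := bP i; rewrite -card_gt0; lia.
  by apply/setIidPl/subsetP => w; rewrite inE => /andP[].
have [||U tU [_ _ US cU]] :=
  @glued_tree b X (enum [pred i | #|h i :&: X| == 1]) trees sX.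
- exact: enum_uniq.
- by move=> i; rewrite mem_enum.
by have := leq_trans cU (treeB _ US tU); rewrite ltnS big_enum.
Qed.

(** Makes the induction descend: [v] is in [S] but not in [w |: C i]. *)
Lemma component_rooted_card i w : w \in h i ->
  #|w |: C i| = #|C i|.+1 /\ #|w |: C i| < #|S|.
Proof.
rewrite inE => /andP[]; rewrite inE => /andP[wS vw] _.
have wR : w \notin R by rewrite !inE vw orbT.
have wi : w \notin C i by apply: contra wR; apply: (subsetP (component_sub i)).
split; first by rewrite cardsU1 wi.
apply: proper_card; apply/properP; split.
  apply/subsetP => x /setU1P[-> //|/(subsetP (component_sub i))].
  by rewrite inE => /andP[].
exists v => //; apply/negP => /setU1P[vw'|/(subsetP (component_sub i))].
  by rewrite -vw' irr_e in vw.
by rewrite !inE eqxx.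
Qed.

(** The closed neighbourhood of [v] in [S] is itself a grown star, so the tree bound applies to
    it. *)
Lemma card_le_non_nbrs k :
  (forall U, U \subset S -> grown_tree v U -> #|U| <= k.+1) ->
  #|S| <= k.+1 + #|R|.
Proof.
move=> treeB; rewrite -(cardsID (closed_nbhd e v) S) leq_add2r.
have -> : S :&: closed_nbhd e v = v |: W.
  by apply/setP => x; rewrite !inE andb_orr; case: eqP => [->|]; rewrite ?vS ?andbF.
apply: treeB; last by apply: grown_tree_star => x; rewrite inE => /andP[].
by apply/subsetP => x /setU1P[-> //|]; rewrite inE => /andP[].
Qed.

End Components.

(** * Quadratic bounds for rooted connected sets *)

Lemma rooted_card_bound S v k : v \in S -> rooted_connected S v ->
  (forall U, U \subset S -> grown_tree v U -> #|U| <= k.+1) ->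
  #|S| <= 'C(k.+1, 2).+1.
Proof.
have [n] := ubnP #|S|; elim: n => // n IH in S v k *; rewrite ltnS => Sn vS conS treeB.
apply: leq_trans (card_le_non_nbrs vS treeB) _.
have leR : #|S :\: closed_nbhd e v| <= 'C(k.-1.+1, 2).
  apply: (non_nbrs_bound_of_components vS conS) => [i w m wi compB|U US tU].
    (* The additional one in the bound on [w |: C i] accounts for [w], leaving the bound on
       [C i]. *)
    have [cardC ltS] := component_rooted_card vS wi; rewrite -ltnS -cardC.
    by apply: IH compB; rewrite ?setU11 //; [lia | apply: component_rooted_connected].
  by apply: leq_trans (treeB _ US tU) _; lia.
(* Star and non-neighbours add up by Pascal's rule. For [k = 0] the value [k.-1.+1] is 1, and the
   binomial coefficient is still zero. *)
by case: k leR {treeB} => [|k] /= leR; [case: #|_| leR | rewrite binS bin1; lia].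
Qed.

Lemma rooted_non_nbrs_bound S v k : v \in S -> rooted_connected S v ->
  (forall U, U \subset S -> grown_tree v U -> #|U| <= k.+2) ->
  #|S :\: closed_nbhd e v| <= 'C(k.+1, 2).
Proof.
move=> vS conS; apply: non_nbrs_bound_of_components => // i w m wi compB.
have [cardC _] := component_rooted_card vS wi; rewrite -ltnS -cardC.
by apply: rooted_card_bound compB; [apply: setU11 | apply: component_rooted_connected].
Qed.

End Graph.

Theorem theorem2 (T : finType) (e : rel T) (k : nat) (v : T) :
  1 <= k ->
  simple_graph e ->
  connected_graph e ->
  triangle_free e ->
  ~ (exists S : {set T}, [/\ #|S| = k.+1, v \in S & induced_tree e S]) ->
  #|~: closed_nbhd e v| <= ((k - 2) * (k - 1)) %/ 2.
Proof.
move=> k_gt0 [sym_e irr_e] con_e tf_e noT.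
(* A larger grown tree could be cut down to exactly [k.+1] vertices, which is excluded. *)
have treeB U : grown_tree e v U -> #|U| <= k.
  move=> tU; rewrite leqNgt; apply/negP => ltU.
  have [|U' tU' cU'] := grown_tree_card (n := k.+1) tU; first exact: ltU.
  apply: noT; exists U'; split=> //; first exact: grown_tree_root tU'.
  exact: grown_tree_induced tU'.
(* For [k = 1] truncated subtraction makes both sides zero. *)
have -> : (k - 2) * (k - 1) %/ 2 = 'C((k - 2).+1, 2).
  rewrite bin2 divn2 /=; case: k {k_gt0 noT treeB} => [|[|k]] //.
  by rewrite !subSS !subn0 mulnC.
rewrite -setTD; apply: rooted_non_nbrs_bound => //.
  move=> x _; have := con_e v x; apply: connect_sub => y z eyz.
  by apply: connect1; rewrite induced_relE !inE.
by move=> U _ /treeB leU; lia.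
Qed.
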